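(* Let $\Omega\subset\mathbb{R}^n$ be a nonempty bounded open set and $K=\overline{\Omega}$. Let $D_1\subset K$ be a countable dense subset of $K$, let $D_2\subset K\setminus D_1$ be a countable set that is dense in $K$, and let $\{(x_j,y_j)\}_{j\in\mathbb{N}}$ be an enumeration of $D_1\times D_2$ (so that $x_j\neq y_j$ for all $j$). Then there exists a constant $C\in(0,1)$ such that for any $\mu\in\mathfrak{M}(K)^c$ there exists a sequence $((\alpha_j^1,\alpha_j^2))_{j\in\mathbb{N}}\in\ell^1(\mathbb{R}^2)$ such that $$\mu=\sum_{j=1}^{+\infty}\left(\frac{\delta_{x_j}-\delta_{y_j}}{|x_j-y_j|}\,\alpha_j^1+\delta_{x_j}\alpha_j^2\right),$$ where the series converges in the norm $\|\cdot\|_{KR}$, and $$C\sum_{j=1}^{+\infty}(|\alpha_j^1|+|\alpha_j^2|)\le\|\mu\|_{KR}\le\sum_{j=1}^{+\infty}(|\alpha_j^1|+|\alpha_j^2|).$$ In particular, the sequence of $\delta$-atoms $(\mu_j)_{j\in\mathbb{N}}\subset\mathfrak{M}(K)$ defined by $$\mu_j=\begin{cases}\dfrac{\delta_{x_k}-\delta_{y_k}}{|x_k-y_k|} & \text{if } j=2k-1,\\[2mm] \delta_{x_k} & \text{if } j=2k,\end{cases}\qquad k=1,2,\dots$$ spans $\mathfrak{M}(K)^c$ (that is, its closed linear span is $\mathfrak{M}(K)^c$), and $\|\mu_j\|_{KR}\le 1$ for any $j\in\mathbb{N}$.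
   Context: $|\cdot|$ is the Euclidean norm on $\mathbb{R}^n$, and $\delta_x$ is the Dirac measure at $x$. $\mathfrak{M}(K)$ is the space of finite signed Borel measures on $K$; for $\mu\in\mathfrak{M}(K)$, $|\mu|$ is its total variation measure; $\mathfrak{M}_0(K)=\{\mu\in\mathfrak{M}(K):\mu(K)=0\}$. For $\nu\in\mathfrak{M}_0(K)$ let $\Psi_\nu$ be the set of finite positive Borel measures $\Psi$ on $K\times K$ with $\Psi(K\times E)-\Psi(E\times K)=\nu(E)$ for every Borel set $E\subset K$, and define $$\|\nu\|_{KR_0}=\inf\left\{\int_{K\times K}|x-y|\,d\Psi(x,y):\ \Psi\in\Psi_\nu\right\}.$$ For $\mu\in\mathfrak{M}(K)$ the (extended) Kantorovich-Rubinstein norm is $$\|\mu\|_{KR}=\inf\{\|\nu\|_{KR_0}+|\mu-\nu|(K):\ \nu\in\mathfrak{M}_0(K)\}.$$ $\mathfrak{M}(K)^c$ denotes the completion of $(\mathfrak{M}(K),\|\cdot\|_{KR})$, with the extended norm still denoted $\|\cdot\|_{KR}$; $\mathfrak{M}(K)$ is regarded as a subspace of its completion. A $\delta$-atom is a measure in $\mathfrak{M}(K)$ with finite support. A sequence $((\alpha_j^1,\alpha_j^2))_j$ is in $\ell^1(\mathbb{R}^2)$ if $\sum_j(|\alpha_j^1|+|\alpha_j^2|)<+\infty$. *)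

(* Defs.v *)
From HB Require Import structures.
From mathcomp Require Import all_boot all_order all_algebra.
From mathcomp Require Import all_classical all_reals all_analysis.

Set Implicit Arguments.
Unset Strict Implicit.
Unset Printing Implicit Defensive.

Import Order.TTheory GRing.Theory Num.Theory.
Import numFieldNormedType.Exports.

Local Open Scope classical_set_scope.
Local Open Scope ring_scope.

(* The norm of the library on ['rV[R]_n] is the sup norm. *)
Definition eucl (R : realType) (n : nat) (v : 'rV[R]_n) : R :=
  Num.sqrt (\sum_(i < n) v ord0 i ^+ 2).

(* A nonempty subset [K] as a space of its own, with the topology induced by
   the ambient space; the proof [K0] only serves to supply the default point
   that measurable types of the library must have. *)
Definition pt_subspace (T : topologicalType) (K : set T) (K0 : K !=set0)
  : Type := set_type K.

Section pt_subspace_instances.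
Variables (T : topologicalType) (K : set T) (K0 : K !=set0).

HB.instance Definition _ := Topological.copy (pt_subspace K0) (set_type K).

HB.instance Definition _ :=
  isPointed.Build (pt_subspace K0) (SigSub (mem_set (projT2 (cid K0)))).

End pt_subspace_instances.

Definition borel (T : topologicalType) := g_sigma_algebraType (@open T).

Section total_variation.
Context d (T : measurableType d) (R : realType).
Variable mu : {charge set T -> \bar R}.

Definition total_variation : set T -> \bar R :=
  charge_variation (projT2 (cid (projT2 (cid (Hahn_decomposition mu))))).

End total_variation.

Section kantorovich_rubinstein.
Variables (R : realType) (n : nat) (K : set 'rV[R]_n) (K0 : K !=set0).

Local Notation KT := (pt_subspace K0).

(* Charges of the library are total functions on sets, whose values on
   non-measurable sets are irrelevant: two charges denote the same signed
   measure as soon as they agree on the measurable sets. *)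
Definition signed_measure := {charge set (borel KT) -> \bar R}.

Definition eucl_dist (x y : KT) : R := eucl (set_val x - set_val y).

Definition signed_measure0 : set signed_measure :=
  [set nu | nu [set: borel KT] = 0%E].

Definition transport_plans (nu : signed_measure)
    : set {finite_measure set (borel (KT * KT)%type) -> \bar R} :=
  [set Psi | forall E : set (borel KT), measurable E ->
     (Psi ([set: KT] `*` E) - Psi (E `*` [set: KT]) = nu E)%E].

Definition KR0_norm (nu : signed_measure) : \bar R :=
  ereal_inf [set (\int[Psi]_z (eucl_dist z.1 z.2)%:E)%E
            | Psi in transport_plans nu].

Definition KR_norm (mu : signed_measure) : \bar R :=
  ereal_inf [set (KR0_norm nu
                  + total_variation (cadd mu (copp nu)) [set: borel KT])%E
            | nu in signed_measure0].

(* [X], with the canonical map [iota], is the completion of the space of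
   signed measures for [KR_norm]. Only charges that agree on the measurable
   sets are identified by [iota], because [KR_norm] separates signed
   measures. *)
Record is_KR_completion (X : completeNormedModType R)
    (iota : signed_measure -> X) : Prop := IsKRCompletion {
  KR_completionD : forall mu nu : signed_measure,
    iota (cadd mu nu) = iota mu + iota nu ;
  KR_completionZ : forall (c : R) (mu : signed_measure),
    iota (cscale c mu) = c *: iota mu ;
  KR_completion_norm : forall mu : signed_measure,
    `|iota mu|%:E = KR_norm mu ;
  KR_completion_dense : dense (range iota) }.

Definition delta (x : KT) : signed_measure :=
  charge_of_finite_measure (dirac (x : borel KT)).

Definition dipole (x y : KT) : signed_measure :=
  cscale (eucl_dist x y)^-1 (cadd (delta x) (copp (delta y))).

Definition support (mu : signed_measure) : set KT :=
  [set x | forall U : set KT, open U -> U x -> (0 < total_variation mu U)%E].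

Definition delta_atom (mu : signed_measure) : Prop := finite_set (support mu).

(* Sequences are indexed from 0: the even terms are the dipoles, the odd
   terms the Dirac measures. *)
Definition atom_seq (x y : nat -> KT) (j : nat) : signed_measure :=
  if odd j then delta (x j./2) else dipole (x j./2) (y j./2).

End kantorovich_rubinstein.

Definition linear_span (R : realType) (V : lmodType R) (u : nat -> V) : set V :=
  [set v | exists (N : nat) (c : nat -> R), v = \sum_(j < N) c j *: u j].

(* Main.v *)
(* The unit ball of the completion is, up to a factor, contained in the closed
   absolutely convex hull of the atoms; the expansion then follows by repeatedly
   halving the residual, and the coefficient sequences add up in l^1.

   To approximate a measure [mu] with [KR_norm mu < r], take an almost optimal
   [nu] and a transport plan [Psi] for it.  Cut [K] into small Borel pieces
   and collapse the positive and negative parts of [mu - nu] to points [x_j]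
   of the pieces: the coefficients add up to the total variation, and the error
   is the cost of moving the mass over a short distance.  Likewise cut [K * K]
   into small pieces and collapse [Psi] to points [(y_j, x_j)]: this turns
   [nu] into a combination of dipoles whose coefficients,
   [|x_j - y_j| * Psi(piece)], add up to nearly the cost of [Psi]. *)

Require Import Defs.
From HB Require Import structures.
From mathcomp Require Import all_boot all_order all_algebra.
From mathcomp Require Import all_classical all_reals all_analysis.
From mathcomp Require Import measurable_realfun ring lra.

Set Implicit Arguments.
Unset Strict Implicit.
Unset Printing Implicit Defensive.

Import Order.TTheory GRing.Theory Num.Theory.
Import numFieldNormedType.Exports.

Local Open Scope classical_set_scope.
Local Open Scope ring_scope.

(** * Expansions with absolutely summable coefficients *)

Section l1_representation.
Context {R : realType} {X : normedModType R}.
Variable w : nat -> X.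

(** Bounding partial sums, rather than the sum of the series, lets bounds be added and passed to
    limits without proving that the absolute values are summable. *)
Definition l1_rep (c : R) (v : X) : Prop := exists a : nat -> R,
  (forall n, \sum_(0 <= j < n) `|a j| <= c) /\
  series (fun j => a j *: w j) @ \oo --> v.

Lemma l1_rep0 : l1_rep 0 0.
Proof.
exists (fun=> 0); split=> [n|]; first by rewrite big1// => j _; rewrite normr0.
apply: cvg_near_cst; near=> n; rewrite /series/= big1// => j _.
by rewrite scale0r.
Unshelve. all: by end_near. Qed.

Lemma l1_repD c1 c2 v1 v2 :
  l1_rep c1 v1 -> l1_rep c2 v2 -> l1_rep (c1 + c2) (v1 + v2).
Proof.
move=> [a1 [b1 l1]] [a2 [b2 l2]]; exists (a1 \+ a2); split=> [n|].
  apply: (le_trans _ (lerD (b1 n) (b2 n))).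
  by rewrite -big_split; apply: ler_sum => j _; exact: ler_normD.
rewrite (_ : series _ = series (fun j => a1 j *: w j)
    \+ series (fun j => a2 j *: w j)); first exact: cvgD.
apply/funext => n; rewrite /series/= -big_split/=.
by apply: eq_bigr => j _; rewrite scalerDl.
Qed.

Lemma l1_repZ (a : R) j : l1_rep `|a| (a *: w j).
Proof.
exists (fun i => if i == j then a else 0); split=> [n|].
  under eq_bigr do rewrite (fun_if Num.norm) normr0.
  rewrite -big_mkcond/=; have [jn|nj] := ltnP j n.
    by rewrite (@big_nat1_eq _ _ _ (fun=> `|a|)) jn.
  by rewrite (@big_nat1_eq _ _ _ (fun=> `|a|)) ltnNge nj/= normr_ge0.
apply: cvg_near_cst; near=> n; rewrite /series/=.
rewrite (eq_bigr (fun i => if i == j then a *: w i else 0)); last first.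
  by move=> i _; case: ifP => // _; rewrite scale0r.
rewrite -big_mkcond/= (@big_nat1_eq _ _ _ (fun i => a *: w i)) ifT//.
by near: n; exact: nbhs_infty_gt.
Unshelve. all: by end_near. Qed.

Lemma l1_repN c v : l1_rep c v -> l1_rep c (- v).
Proof.
move=> [a [b l]]; exists (\- a); split=> [n|].
  by under eq_bigr do rewrite normrN.
rewrite (_ : series _ = \- series (fun j => a j *: w j)); first exact: cvgN.
apply/funext => n; rewrite /series/= -sumrN.
by apply: eq_bigr => j _; rewrite scaleNr.
Qed.

Lemma l1_repW c1 c2 v : c1 <= c2 -> l1_rep c1 v -> l1_rep c2 v.
Proof.
by move=> c12 [a [b l]]; exists a; split=> // n; exact: le_trans c12.
Qed.

Lemma l1_rep_sum (I : Type) (s : seq I) (c : I -> R) (u : I -> X) :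
  (forall i, l1_rep (c i) (u i)) ->
  l1_rep (\sum_(i <- s) c i) (\sum_(i <- s) u i).
Proof.
move=> cu; elim: s => [|i s IHs]; first by rewrite !big_nil; exact: l1_rep0.
by rewrite !big_cons; exact: l1_repD.
Qed.

(** Stage [k] of the iteration costs at most [M |v| / 2^k], whence the factor 2. All stages use the
    same vectors [w j], so their coefficients are added index by index; l^1 bounds uniform in the
    number of terms justify exchanging the two limits. *)
Lemma l1_rep_expansion (M : R) : 0 <= M -> (forall j, `|w j| <= 1) ->
  (forall v, exists2 v', l1_rep (M * `|v|) v' & `|v - v'| <= `|v| / 2) ->
  forall v, l1_rep (2 * M * `|v|) v.
Proof.
move=> M0 w1 approx v.
have /choice[step stepP] : forall u : X, exists ar : (nat -> R) * X,
    [/\ forall n, \sum_(0 <= j < n) `|ar.1 j| <= M * `|u|,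
        series (fun j => ar.1 j *: w j) @ \oo --> u - ar.2 &
        `|ar.2| <= `|u| / 2].
  move=> u; have [u' [a [b l]] uu'] := approx u.
  by exists (a, u - u'); split; rewrite //= opprB addrC subrK.
(* [r k] is the residual left after [k] stages, and [a k] the coefficients of the stage applied to
   it. *)
pose r := fix r k := if k is k'.+1 then (step (r k')).2 else v.
pose a k := (step (r k)).1.
have r_le k : `|r k| <= `|v| * 2^-1 ^+ k.
  elim: k => [|k IHk]; first by rewrite expr0 mulr1.
  have [_ _ /le_trans] := stepP (r k); apply.
  by rewrite exprSr mulrA ler_pM2r.
have a_le k n : \sum_(0 <= j < n) `|a k j| <= M * `|v| * 2^-1 ^+ k.
  have [/(_ n)/le_trans + _ _] := stepP (r k); apply.
  by rewrite -mulrA ler_wpM2l.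
pose S k j := \sum_(0 <= l < k) a l j.
have S_cvg k : series (fun j => S k j *: w j) @ \oo --> v - r k.
  elim: k => [|k IHk].
    rewrite /= subrr; apply: cvg_near_cst; near=> n.
    by rewrite /series/= big1// => j _; rewrite /S big_geq// scale0r.
  rewrite (_ : v - _ = (v - r k) + (r k - r k.+1)); last by rewrite addrA subrK.
  rewrite (_ : series _ = series (fun j => S k j *: w j)
    \+ series (fun j => a k j *: w j)); last first.
    apply/funext => n; rewrite /series/= -big_split/=.
    by apply: eq_bigr => j _; rewrite /S big_nat_recr//= scalerDl.
  by apply: cvgD => //; have [] := stepP (r k).
(* Written as a difference of powers, the bound telescopes in the induction on [p]. *)
have S_dist k p n : \sum_(0 <= j < n) `|S (k + p)%N j - S k j| <=
    2 * M * `|v| * (2^-1 ^+ k - 2^-1 ^+ (k + p)).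
  elim: p => [|p IHp].
    by rewrite addn0 subrr mulr0 big1// => j _; rewrite subrr normr0.
  rewrite addnS; apply: (@le_trans _ _ (\sum_(0 <= j < n)
      (`|S (k + p)%N j - S k j| + `|a (k + p)%N j|))).
    apply: ler_sum => j _; rewrite /S big_nat_recr//= addrAC.
    exact: ler_normD.
  rewrite big_split/=; apply: le_trans (lerD IHp (a_le _ _)) _.
  rewrite [2^-1 ^+ (k + p).+1]exprSr.
  by rewrite le_eqVlt; apply/orP; left; apply/eqP; field.
pose b j := limn (fun k => S k j).
have S_lim j : S ^~ j @ \oo --> b j.
  suff: cvgn (series (fun l => a l j)) by [].
  apply: normed_cvg; apply: (@series_le_cvg _ _
    (geometric (M * `|v|) 2^-1)) => [k|k|k|] //=.
  - by rewrite mulr_ge0 ?mulr_ge0// exprn_ge0.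
  - apply: le_trans (a_le k j.+1); rewrite big_nat_recr//= lerDr.
    exact: sumr_ge0.
  - by apply: is_cvg_geometric_series; rewrite ger0_norm// invf_lt1// ltr1n.
have b_dist k n : \sum_(0 <= j < n) `|b j - S k j| <=
    2 * M * `|v| * 2^-1 ^+ k.
  have : (fun m => \sum_(0 <= j < n) `|S m j - S k j|) @ \oo -->
      \sum_(0 <= j < n) `|b j - S k j|.
    apply: cvg_big => [|j _]; first exact: add_continuous.
    by apply: cvg_norm; apply: cvgB => //; exact: cvg_cst.
  move=> /cvgr_to_le; apply.
  near=> m; have km : (k <= m)%N by near: m; exact: nbhs_infty_ge.
  rewrite -(subnKC km); apply: le_trans (S_dist _ _ _) _.
  by rewrite ler_wpM2l ?mulr_ge0// gerBl exprn_ge0.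
exists b; split=> [n|].
  (* Since [S 0] is zero, the case [k = 0] bounds the coefficients themselves. *)
  have := b_dist 0%N n; rewrite expr0 mulr1; apply: le_trans.
  by apply: ler_sum => j _; rewrite /S big_geq// subr0.
apply/cvgrPdist_le => e e0.
have e20 : 0 < e / 2 by rewrite divr_gt0.
(* [K / 2^k] bounds the residual [r k] plus the error of replacing [b] by [S k], as the [w j] have
   norm at most 1. *)
pose K := `|v| + 2 * M * `|v|.
have : (fun k => K * 2^-1 ^+ k) @ \oo --> K * 0.
  apply: cvgM; first exact: cvg_cst.
  by apply: cvg_expr; rewrite ger0_norm// invf_lt1// ltr1n.
rewrite mulr0 => /cvgrPdist_le/(_ _ e20)[k _ /(_ k (leqnn k))].
rewrite /= sub0r normrN => Kk.
have /cvgrPdist_le/(_ _ e20) := S_cvg k.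
apply: filterS => n Hn; rewrite /series/=.
rewrite (_ : v - _ = (v - r k - series (fun j => S k j *: w j) n)
  + (r k - \sum_(0 <= j < n) (b j - S k j) *: w j)); last first.
  rewrite (_ : \sum_(0 <= j < n) (b j - _) *: _ = \sum_(0 <= j < n) b j *: w j -
    series (fun j => S k j *: w j) n); last first.
    by rewrite /series/= -sumrB; apply: eq_bigr => j _; rewrite scalerBl.
  by rewrite opprB (addrA (r k)) -(addrA v) -opprD addrA subrK.
apply: le_trans (ler_normD _ _) _; rewrite [e]splitr lerD//.
apply: le_trans (ler_normB _ _) _; apply: le_trans Kk.
apply: le_trans (ler_norm _); rewrite mulrDl lerD//.
apply: le_trans (ler_norm_sum _ _ _) _; apply: le_trans (b_dist k n).
by apply: ler_sum => j _; rewrite normrZ -[leRHS]mulr1 ler_wpM2l.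
Unshelve. all: by end_near. Qed.

End l1_representation.

(** * Borel sets, continuity and finite Borel partitions *)

(* The library does not join the topological and the pointed structures of a
   product; [borel] needs the join. *)
HB.instance Definition _ (T U : ptopologicalType) :=
  Pointed.on (T * U)%type.

Lemma open_borel_measurable (T : ptopologicalType) (U : set T) :
  open U -> measurable (U : set (borel T)).
Proof. by move=> oU; apply: sub_sigma_algebra. Qed.

Lemma borel_measurable_fun d (T : measurableType d) (Y : ptopologicalType)
    (f : T -> borel Y) :
  (forall U : set Y, open U -> measurable (f @^-1` U)) ->
  measurable_fun [set: T] f.
Proof.
move=> fU; apply: (@measurability _ _ T (borel Y) setT f (@open Y)) => //.
by move=> _ [U oU <-]; rewrite setTI; exact: fU.
Qed.

Lemma continuous_borel_measurable_fun (T Y : ptopologicalType) (f : T -> Y) :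
  continuous f -> measurable_fun [set: borel T] (f : borel T -> borel Y).
Proof.
move=> /continuousP cf; apply: borel_measurable_fun => U oU.
by apply: open_borel_measurable; exact: cf.
Qed.

Lemma continuous_borel_measurable_funR (R : realType) (T : ptopologicalType)
    (f : T -> R) : continuous f ->
  measurable_fun [set: borel T] (f : borel T -> R).
Proof.
move=> /continuousP cf.
apply: (measurability _ (RGenOpens.measurableE R)).
move=> _ [_ [a [b ->]] <-]; rewrite setTI.
by apply: open_borel_measurable; apply: cf; exact: interval_open.
Qed.

(** Sending [t] to the first [j] with [U j t] makes each fibre an open set minus finitely many open
    sets, hence Borel; a finite subcover bounds the index. The fibres are the small pieces on which
    measures are collapsed. *)
Lemma borel_first_index (T : ptopologicalType) (U : nat -> set T) :
  compact [set: T] -> (forall j, open (U j)) -> (forall t, exists j, U j t) ->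
  exists N (l : T -> nat), [/\ forall t, (l t < N)%N, forall t, U (l t) t &
    forall j, measurable (l @^-1` [set j] : set (borel T))].
Proof.
rewrite compact_cover => cT oU covU.
have [F _ TF] := cT nat setT U (fun j _ => oU j)
  (fun t _ => let: ex_intro j Ujt := covU t in ex_intro2 _ _ j I Ujt).
have /choice[l lP] : forall t, exists j, seqDU U j t.
  move=> t; have : (\bigcup_j U j) t by have [j] := covU t; exists j.
  by rewrite seqDU_bigcup_eq => -[j _]; exists j.
have lE t j : seqDU U j t -> l t = j.
  move=> jt; apply: (@trivIset_seqDU _ U) => //; exists t.
  by split; [exact: lP|].
exists (\max_(j <- finmap.enum_fset F) j).+1, l; split.
- move=> t; have [j /= jF Ujt] := TF t I.
  apply: (@leq_ltn_trans j); last first.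
    by rewrite ltnS; apply: (@leq_bigmax_seq _ _ xpredT id).
  rewrite leqNgt; apply/negP => jl; have [_ /=] := lP t; apply.
  by rewrite -bigcup_mkord; exists j.
- by move=> t; have [] := lP t.
- move=> j; rewrite (_ : _ @^-1` _ = seqDU U j); last first.
    by apply/seteqP; split => t /= => [<-|]; [exact: lP|exact: lE].
  apply: measurableD; first exact: open_borel_measurable.
  by apply: bigsetU_measurable => i _; exact: open_borel_measurable.
Qed.

Lemma continuous_pair_cst (T U : topologicalType) (a : T) :
  continuous (fun b : U => (a, b)).
Proof. by move=> b; apply: cvg_pair; [exact: cvg_cst|exact: cvg_id]. Qed.

Lemma open_lt_continuous (R : realType) (T : topologicalType) (f : T -> R)
    (c : R) : continuous f -> open [set t | f t < c].
Proof. by move=> cf; apply: (@open_comp _ _ f [set u | u < c]). Qed.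

Lemma open_gt_continuous (R : realType) (T : topologicalType) (f : T -> R)
    (c : R) : continuous f -> open [set t | c < f t].
Proof. by move=> cf; apply: (@open_comp _ _ f [set u | c < u]). Qed.

Lemma open_preimage_fst (T U : topologicalType) (A : set T) :
  open A -> open [set z : T * U | A z.1].
Proof.
by move=> oA; apply: (@open_comp _ _ fst A) => // z _; exact: cvg_fst.
Qed.

Lemma open_preimage_snd (T U : topologicalType) (A : set U) :
  open A -> open [set z : T * U | A z.2].
Proof.
by move=> oA; apply: (@open_comp _ _ snd A) => // z _; exact: cvg_snd.
Qed.

(** * Image measures *)

Section image_measure.
Context d d' (T : measurableType d) (T' : measurableType d') (R : realType).
Variables (P : {finite_measure set T -> \bar R}) (f : T -> T').
Hypothesis mf : measurable_fun [set: T] f.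

(** The measurability proof is an argument so that the measure structures can be inferred from the
    term. *)
Definition image_measure & measurable_fun [set: T] f : set T' -> \bar R :=
  pushforward P f.

Let image_measure0 : image_measure mf set0 = 0%E.
Proof. exact: measure0. Qed.

Let image_measure_ge0 A : (0 <= image_measure mf A)%E.
Proof. exact: measure_ge0. Qed.

Let image_measure_sigma_additive : semi_sigma_additive (image_measure mf).
Proof. exact: measure_semi_sigma_additive. Qed.

HB.instance Definition _ := isMeasure.Build _ _ _ (image_measure mf)
  image_measure0 image_measure_ge0 image_measure_sigma_additive.

Let image_measure_fin : fin_num_fun (image_measure mf).
Proof.
move=> U mU; apply: fin_num_measure.
by rewrite -[X in measurable X]setTI; exact: mf.
Qed.

HB.instance Definition _ :=
  @Measure_isFinite.Build _ T' R (image_measure mf) image_measure_fin.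

End image_measure.

(** * Jordan and Hahn forms of the total variation *)

(* The unqualified [total_variation] is that of a real function. *)
Lemma total_variation_jordan d (T : measurableType d) (R : realType)
    (mu : {charge set T -> \bar R}) :
  exists m1 m2 : {finite_measure set T -> \bar R},
    (forall A, measurable A -> mu A = (m1 A - m2 A)%E) /\
    Defs.total_variation mu [set: T] = (m1 [set: T] + m2 [set: T])%E.
Proof.
rewrite /Defs.total_variation; case: cid => P exN /=; case: cid => N h /=.
exists (jordan_pos h), (jordan_neg h); split=> // A mA.
rewrite (jordan_decomp h mA).
by rewrite -[LHS]/(jordan_pos h A + cscale (-1) (jordan_neg h) A)%E cscaleN1.
Qed.

(** Reduces claims on the variation to values of [mu] itself, hiding how the Hahn sets were
    chosen. *)
Lemma total_variation_hahn d (T : measurableType d) (R : realType)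
    (mu : {charge set T -> \bar R}) :
  exists P N : set T, [/\ measurable P, measurable N &
    forall A, measurable A ->
      Defs.total_variation mu A = (mu (A `&` P) - mu (A `&` N))%E].
Proof.
rewrite /Defs.total_variation; case: cid => P exN /=; case: cid => N h /=.
have [[mP _] [mN _] _ _] := h.
eexists; eexists; split; [exact: mP|exact: mN|move=> A mA].
rewrite /charge_variation /= jordan_posE cjordan_posE jordan_negE cjordan_negE.
by rewrite /crestr0 mem_set.
Qed.

Lemma total_variation0 d (T : measurableType d) (R : realType)
    (mu : {charge set T -> \bar R}) :
  (forall A, measurable A -> mu A = 0%E) ->
  Defs.total_variation mu [set: T] = 0%E.
Proof.
move=> mu0; have [P [N [mP mN ->]]] := total_variation_hahn mu => //.
by rewrite !setTI !mu0// sube0.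
Qed.

Lemma total_variation_le d (T : measurableType d) (R : realType)
    (mu : {charge set T -> \bar R}) (m : {finite_measure set T -> \bar R}) :
  (forall A, measurable A -> mu A = m A) ->
  (Defs.total_variation mu [set: T] <= m [set: T])%E.
Proof.
move=> mum; have [P [N [mP mN ->]]] := total_variation_hahn mu => //.
rewrite !setTI !mum// -[leRHS]sube0 leeB//.
by apply: le_measure; rewrite ?inE.
Qed.

(** * Euclidean distance and topology of the subspace [K] *)

Section kantorovich_rubinstein_theory.
Context {R : realType} {n : nat} {K : set 'rV[R]_n} (K0 : K !=set0).

Local Notation KT := (pt_subspace K0).
Local Notation charges := (signed_measure K0).

Lemma eucl_distxx (a : KT) : eucl_dist a a = 0.
Proof.
rewrite /eucl_dist subrr /eucl big1 ?sqrtr0// => i _.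
by rewrite mxE expr0n.
Qed.

Lemma eucl_distC (a b : KT) : eucl_dist a b = eucl_dist b a.
Proof.
rewrite /eucl_dist -opprB /eucl; congr Num.sqrt.
by apply: eq_bigr => i _; rewrite mxE sqrrN.
Qed.

Lemma eucl_dist_ge0 (a b : KT) : 0 <= eucl_dist a b.
Proof. exact: sqrtr_ge0. Qed.

Lemma set_val_continuous : continuous (set_val : KT -> 'rV[R]_n).
Proof. exact: initial_continuous. Qed.

(** Continuity is checked on coordinates, so the Euclidean and sup norms are never compared. *)
Lemma eucl_dist_continuous :
  continuous (fun z : (KT * KT)%type => eucl_dist z.1 z.2).
Proof.
rewrite (_ : (fun _ => _) = (@Num.sqrt R) \o (fun z : KT * KT =>
  \sum_(i < n) (set_val z.1 - set_val z.2) ord0 i ^+ 2)) => // z.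
apply: continuous_comp; last exact: sqrt_continuous.
apply: cvg_big => [|i _]; first exact: add_continuous.
apply: (@continuous_comp _ _ _
  (fun z : KT * KT => (set_val z.1 - set_val z.2) ord0 i) (fun u => u ^+ 2));
  last exact: exprn_continuous.
apply: (@continuous_comp _ _ _
  (fun z : KT * KT => set_val z.1 - set_val z.2) (fun u => u ord0 i));
  last exact: coord_continuous.
apply: cvgB.
  by apply: continuous_comp; [exact: cvg_fst|exact: set_val_continuous].
by apply: continuous_comp; [exact: cvg_snd|exact: set_val_continuous].
Qed.

Lemma eucl_distl_continuous (a : KT) : continuous (eucl_dist a).
Proof.
move=> b; apply: (@continuous_comp _ _ _ (fun b => (a, b))
  (fun z : (KT * KT)%type => eucl_dist z.1 z.2)).
  exact: continuous_pair_cst.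
exact: eucl_dist_continuous.
Qed.

Lemma open_eucl_ball (a : KT) (e : R) : open [set b | eucl_dist a b < e].
Proof.
exact/open_lt_continuous/eucl_distl_continuous.
Qed.

(** A filter on the subspace is pushed to the ambient space, where it clusters in [K]; subspace
    neighbourhoods are traces of ambient ones, so the cluster point can be pulled back. *)
Lemma compact_pt_subspace : compact K -> compact [set: KT].
Proof.
move=> cK F FF _.
have [|p [Kp clp]] := cK (set_val @ F) (fmap_proper_filter _ FF).
  by apply: nearW => -[a aK]; exact: set_mem.
pose q : KT := SigSub (mem_set Kp); exists q; split=> // A B FA.
move=> [_ [[V oV <-] Vp] VB].
have FA' : (set_val @ F) (set_val @` A).
  by apply: (@filterS _ F _ A) => // a Aa; exists a.
have pV : nbhs p V by exact: open_nbhs_nbhs.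
have [_ [[a Aa <-] Va]] := clp _ _ FA' pV.
by exists a; split=> //; exact: VB.
Qed.

Lemma closed_pt_subspace1 (a : KT) : closed [set a].
Proof.
rewrite (_ : [set a] = set_val @^-1` [set set_val a]).
  apply: closed_comp => [b _|]; first exact: set_val_continuous.
  exact: accessible_closed_set1 (hausdorff_accessible (@norm_hausdorff _ _)) _.
by apply/seteqP; split=> [_ ->//|b /= /val_inj].
Qed.

End kantorovich_rubinstein_theory.

(** * Bounding the Kantorovich-Rubinstein norm by explicit plans *)

Section kantorovich_rubinstein_norm.
Context {R : realType} {n : nat} {K : set 'rV[R]_n} {K0 : K !=set0}.

Local Notation KT := (pt_subspace K0).
Local Notation charges := (signed_measure K0).

Lemma measurable_fst_borel :
  measurable_fun [set: borel (KT * KT)%type]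
    (fst : borel (KT * KT)%type -> borel KT).
Proof.
apply: (@continuous_borel_measurable_fun _ _ (fst : (KT * KT)%type -> KT)).
by move=> z; exact: cvg_fst.
Qed.

Lemma measurable_snd_borel :
  measurable_fun [set: borel (KT * KT)%type]
    (snd : borel (KT * KT)%type -> borel KT).
Proof.
apply: (@continuous_borel_measurable_fun _ _ (snd : (KT * KT)%type -> KT)).
by move=> z; exact: cvg_snd.
Qed.

Lemma measurable_eucl_dist :
  measurable_fun [set: borel (KT * KT)%type]
    (fun z : borel (KT * KT)%type => (eucl_dist z.1 z.2)%:E).
Proof.
apply/measurable_EFinP.
exact: (continuous_borel_measurable_funR (@eucl_dist_continuous R n K K0)).
Qed.

(** [mu] itself is the competitor in the infimum: its mass is zero because both marginals of [Psi]
    have the same mass, and the variation term vanishes. *)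
Lemma KR_norm_plan (mu : charges)
    (Psi : {finite_measure set (borel (KT * KT)%type) -> \bar R}) :
  transport_plans mu Psi ->
  (KR_norm mu <= \int[Psi]_z (eucl_dist z.1 z.2)%:E)%E.
Proof.
move=> muPsi; apply: ge_ereal_inf; eexists.
  exists mu => //; rewrite /signed_measure0/=.
  rewrite -muPsi// setXTT subee//; exact: fin_num_measure.
rewrite total_variation0 ?adde0; last first.
  by move=> A mA; apply: subee; exact: fin_num_measure.
by apply: ereal_inf_lbound; exists Psi.
Qed.

(** The image of [P] under [(f, g)] is the plan. As [P] may live on any space, this covers both
    moving a point mass and collapsing a measure piece by piece. *)
Lemma KR_norm_transport d (T : measurableType d)
    (P : {finite_measure set T -> \bar R}) (f g : T -> borel KT)
    (mu : charges) :
  measurable_fun [set: T] (fun t => (f t, g t) : borel (KT * KT)%type) ->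
  (forall E, measurable E -> mu E = (P (g @^-1` E) - P (f @^-1` E))%E) ->
  (KR_norm mu <= \int[P]_t (@eucl_dist R n K K0 (f t) (g t))%:E)%E.
Proof.
move=> mfg muE.
pose Psi : {finite_measure set (borel (KT * KT)%type) -> \bar R} :=
  image_measure P mfg.
apply: le_trans (@KR_norm_plan mu Psi _) _.
  move=> E mE; rewrite muE// /Psi /= /image_measure /pushforward/=.
  congr (P _ - P _)%E; apply/seteqP; split => t /=; tauto.
rewrite /Psi /image_measure ge0_integral_pushforward//.
- exact: measurable_eucl_dist.
- by move=> z _; rewrite lee_fin eucl_dist_ge0.
Qed.

(** With the competitor [nu = 0] only the variation of the Dirac measure remains; a plan
    concentrated at the diagonal point [(a, a)] realises [nu = 0] at no cost. *)
Lemma KR_norm_delta (a : KT) : (KR_norm (delta a) <= 1)%E.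
Proof.
apply: (@le_trans _ _ (KR0_norm (czero : charges) +
    Defs.total_variation (cadd (delta a) (copp (czero : charges)))
      [set: borel KT])%E).
  by apply: ereal_inf_lbound; exists czero.
rewrite -[leRHS]add0e leeD//.
  apply: ereal_inf_lbound; exists (dirac ((a, a) : borel (KT * KT)%type)).
    move=> E mE; rewrite /= /dirac !indicE !in_setX/= !in_setT andbT.
    by rewrite -EFinD subrr.
  rewrite integral_dirac//= ?eucl_distxx ?diracT ?mul1e//.
  exact: measurable_eucl_dist.
have := @total_variation_le _ _ R (cadd (delta a) (copp (czero : charges)))
  (dirac (a : borel KT)).
rewrite /= diracT; apply=> A mA.
by rewrite -[LHS]/(dirac (a : borel KT) A - 0)%E sube0.
Qed.

End kantorovich_rubinstein_norm.

(** * Maps that factor through a measurable index *)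

Section index_fun.
Context d (T : measurableType d) (l : T -> nat).
Hypothesis ml : forall j, measurable (l @^-1` [set j]).

(** The target carries the Borel sets of the product topology, so open sets of the product are
    tested directly: on each of the countably many fibres of [l] the first component is fixed, and
    only an open section matters. *)
Lemma measurable_index_pair (Y Z : ptopologicalType) (x : nat -> Y)
    (f : T -> borel Z) : measurable_fun [set: T] f ->
  measurable_fun [set: T] (fun t => (x (l t), f t) : borel (Y * Z)%type).
Proof.
move=> mf; apply: (@borel_measurable_fun _ _ (Y * Z)%type) => U oU.
rewrite (_ : _ @^-1` U = \bigcup_j (l @^-1` [set j] `&`
    f @^-1` [set b | U (x j, b)])); last first.
  apply/seteqP; split=> [t Ut|t [_ _ [/= <-]]//].
  by exists (l t).
apply: bigcupT_measurable => j; apply: measurableI => //.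
rewrite -[X in measurable X]setTI; apply: mf => //.
apply: (@open_borel_measurable Z).
by move: oU; apply: open_comp => b _; exact: continuous_pair_cst.
Qed.

(** Identifies the image of [P] under [x \o l] as a finite sum of point masses; this is how
    collapsed measures become combinations of the [delta (x j)]. *)
Lemma measure_index_preimage (R : realType)
    (P : {finite_measure set T -> \bar R}) (N : nat) (Y : Type)
    (x : nat -> Y) (E : set Y) :
  (forall t, (l t < N)%N) ->
  (P ((x \o l) @^-1` E) =
    \sum_(j < N) (fine (P (l @^-1` [set j : nat])))%:E * (\1_E (x j))%:E)%E.
Proof.
move=> lN; pose F j := l @^-1` [set j] `&` [set _ | E (x j)].
have mF j : measurable (F j).
  apply: measurableI => //; have [Ej|nEj] := pselect (E (x j)).
    by rewrite (_ : [set _ | _] = setT)//; apply/seteqP; split.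
  by rewrite (_ : [set _ | _] = set0)//; apply/seteqP; split.
rewrite (_ : _ @^-1` E = \big[setU/set0]_(j < N) F j); last first.
  rewrite -bigcup_mkord; apply/seteqP; split=> [t Et|t [_ _ [/= <-]]//].
  by exists (l t) => //=.
rewrite (@measure_semi_additive_ord_I _ _ _ P F)//; last 2 first.
- by move=> i j _ _ [t [[/= <- _] [/= <- _]]].
- exact: bigsetU_measurable.
apply: eq_bigr => j _; rewrite fineK ?fin_num_measure// indicE /F.
have [Ej|nEj] := pselect (E (x j)).
  by rewrite mem_set// mule1; congr (P _); apply/seteqP; split=> t // [].
rewrite memNset// mule0 -(measure0 P); congr (P _).
by apply/seteqP; split=> t // [].
Qed.

Lemma measure_index_total (R : realType) (P : {finite_measure set T -> \bar R})
    (N : nat) : (forall t, (l t < N)%N) ->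
  \sum_(j < N) fine (P (l @^-1` [set j : nat])) = fine (P [set: T]).
Proof.
(* The constant map to [unit] turns the formula for preimages into one for the total mass. *)
move=> lN; have := measure_index_preimage P (fun=> tt) setT lN.
rewrite preimage_setT => ->; rewrite -[LHS]/(fine _%:E) -sumEFin.
by congr fine; apply: eq_bigr => j _; rewrite indicE mem_set// mule1.
Qed.

End index_fun.

(** * Computing in the completion *)

Section KR_completion_theory.
Context {R : realType} {n : nat} {K : set 'rV[R]_n} {K0 : K !=set0}.

Local Notation KT := (pt_subspace K0).
Local Notation charges := (signed_measure K0).

Context {X : completeNormedModType R} {iota : charges -> X}.
Hypothesis iota_KR : is_KR_completion iota.

Let iotaD := KR_completionD iota_KR.
Let iotaZ := KR_completionZ iota_KR.
Let iota_norm := KR_completion_norm iota_KR.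

Lemma KR_completion_transport0 d (T : measurableType d)
    (P : {finite_measure set T -> \bar R}) (f g : T -> borel KT)
    (mu : charges) :
  measurable_fun [set: T] (fun t => (f t, g t) : borel (KT * KT)%type) ->
  (forall E, measurable E -> mu E = (P (g @^-1` E) - P (f @^-1` E))%E) ->
  (`|iota mu|%:E <= \int[P]_t (@eucl_dist R n K K0 (f t) (g t))%:E)%E.
Proof. by move=> mfg muE; rewrite iota_norm; exact: KR_norm_transport. Qed.

(** The difference vanishes on measurable sets, so a unit mass resting at one point is a plan for
    it, of cost zero. Identities in [X] can thus be checked on measurable sets. *)
Lemma KR_completion_eq (mu nu : charges) :
  (forall E, measurable E -> mu E = nu E) -> iota mu = iota nu.
Proof.
move=> munu; apply/eqP; rewrite -subr_eq0 -normr_le0 -scaleN1r -iotaZ -iotaD.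
rewrite -lee_fin.
apply: le_trans (@KR_completion_transport0 _ _
  (dirac (point : borel KT)) (fun=> point) (fun=> point) _ _ _) _ => //.
- move=> E mE; rewrite subee ?fin_num_measure//.
  rewrite -[LHS]/(mu E + (-1)%:E * nu E)%E munu// mulN1e subee//.
    exact: fin_num_measure.
  by rewrite preimage_cst; case: ifP.
by rewrite integral0_eq// => a _; rewrite eucl_distxx.
Qed.

Lemma KR_completionN (mu : charges) : iota (copp mu) = - iota mu.
Proof.
rewrite -scaleN1r -iotaZ; apply: KR_completion_eq => E mE.
by rewrite -[RHS]/((-1)%:E * mu E)%E mulN1e.
Qed.

Lemma KR_completionB (mu nu : charges) :
  iota (cadd mu (copp nu)) = iota mu - iota nu.
Proof. by rewrite iotaD KR_completionN. Qed.

Lemma KR_completion_sum (N : nat) (c : nat -> R) (u : nat -> charges)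
    (mu : charges) :
  (forall E, measurable E -> mu E = (\sum_(j < N) (c j)%:E * u j E)%E) ->
  iota mu = \sum_(j < N) c j *: iota (u j).
Proof.
elim: N mu => [|N IHN] mu muE.
  rewrite big_ord0 -(scale0r (iota mu)) -iotaZ.
  apply: KR_completion_eq => E mE.
  by rewrite muE// big_ord0 -[RHS]/(0%:E * mu E)%E mul0e.
rewrite big_ord_recr/= -(IHN (cadd mu (cscale (- c N) (u N)))).
  by rewrite iotaD iotaZ scaleNr subrK.
move=> E mE; rewrite -[LHS]/(mu E + (- c N)%:E * u N E)%E muE// big_ord_recr/=.
rewrite EFinN mulNe addeK// fin_numM//; exact: fin_num_measure.
Qed.

Lemma KR_completion_transport d (T : measurableType d)
    (P : {finite_measure set T -> \bar R}) (f g : T -> borel KT)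
    (mu nu : charges) :
  measurable_fun [set: T] (fun t => (f t, g t) : borel (KT * KT)%type) ->
  (forall E, measurable E -> mu E = P (g @^-1` E)) ->
  (forall E, measurable E -> nu E = P (f @^-1` E)) ->
  (`|iota mu - iota nu|%:E <=
    \int[P]_t (@eucl_dist R n K K0 (f t) (g t))%:E)%E.
Proof.
move=> mfg muE nuE; rewrite -KR_completionB.
apply: KR_completion_transport0 => // E mE.
by rewrite -muE// -nuE.
Qed.

(** Each [f t] is matched with the point [x (l t)] of its piece, at distance at most [e]. Keeping
    [T] and [f] general allows both coordinates of a plan on [K * K] to be discretized with the same
    partition. *)
Lemma KR_completion_discretize d (T : measurableType d)
    (P : {finite_measure set T -> \bar R}) (f : T -> borel KT) (mu : charges)
    (l : T -> nat) (N : nat) (x : nat -> KT) (e : R) :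
  measurable_fun [set: T] f ->
  (forall E, measurable E -> mu E = P (f @^-1` E)) ->
  (forall j, measurable (l @^-1` [set j])) -> (forall t, (l t < N)%N) ->
  (forall t, @eucl_dist R n K K0 (x (l t)) (f t) <= e) ->
  `|iota mu -
    \sum_(j < N) fine (P (l @^-1` [set j : nat])) *: iota (delta (x j))| <=
  e * fine (P [set: T]).
Proof.
move=> mf muE ml lN xf; have mxf := measurable_index_pair ml x mf.
have mx : measurable_fun [set: T] (x \o l : T -> borel KT).
  exact: (measurableT_comp (@measurable_fst_borel R n K K0) mxf).
pose nu : charges := charge_of_finite_measure (image_measure P mx).
have <- : iota nu =
    \sum_(j < N) fine (P (l @^-1` [set j : nat])) *: iota (delta (x j)).
  apply: (@KR_completion_sum N (fun j => fine (P (l @^-1` [set j])))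
    (fun j => delta (x j))) => E mE.
  exact: (measure_index_preimage ml P x E lN).
rewrite -lee_fin; apply: le_trans (KR_completion_transport mxf muE _) _ => //.
apply: (@le_trans _ _ (\int[P]_t (cst e%:E t))%E).
  apply: ge0_le_integral => //.
  - by move=> t _; rewrite lee_fin eucl_dist_ge0.
  - apply: (measurableT_comp (@measurable_eucl_dist R n K K0) mxf).
  - by move=> t _; rewrite lee_fin.
by rewrite integral_cst// EFinM fineK// fin_num_measure.
Qed.

Lemma KR_completion_delta_le (a : KT) : `|iota (delta a)| <= 1.
Proof. by rewrite -lee_fin iota_norm KR_norm_delta. Qed.

Lemma KR_completion_deltaB_le (a b : KT) :
  `|iota (delta a) - iota (delta b)| <= eucl_dist a b.
Proof.
rewrite -lee_fin.
apply: le_trans (@KR_completion_transport _ _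
  (* Constant maps on a Dirac measure carry a unit mass from [b] to [a]. *)
  (dirac (point : borel KT)) (fun=> b) (fun=> a) _ _ _ _ _) _ => //.
by rewrite integral_cst//= diracT mule1 eucl_distC.
Qed.

(* Also true at [a = b], where [dipole a b] has the factor [0^-1 = 0]. *)
Lemma KR_completion_dipole (a b : KT) :
  eucl_dist a b *: iota (dipole a b) = iota (delta a) - iota (delta b).
Proof.
rewrite iotaZ KR_completionB scalerA.
have [ab0|ab0] := eqVneq (eucl_dist a b) 0; last by rewrite divff// scale1r.
have := KR_completion_deltaB_le a b.
by rewrite ab0 mul0r scale0r normr_le0 => /eqP ->.
Qed.

Lemma KR_completion_dipole_le (a b : KT) : `|iota (dipole a b)| <= 1.
Proof.
rewrite iotaZ KR_completionB normrZ ger0_norm ?invr_ge0 ?eucl_dist_ge0//.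
apply: (@le_trans _ _ ((eucl_dist a b)^-1 * eucl_dist a b)).
  by rewrite ler_wpM2l ?invr_ge0 ?eucl_dist_ge0// KR_completion_deltaB_le.
(* At distance zero the product is 0, not 1. *)
have [->|ab0] := eqVneq (eucl_dist a b) 0; first by rewrite mulr0.
by rewrite mulVf.
Qed.

End KR_completion_theory.

(** * Approximating a charge by combinations of atoms *)

Lemma small_factor (R : realFieldType) (s e A : R) :
  0 < s -> 0 < e -> 0 <= A -> exists2 c, 0 < c & c * A <= s /\ c * A <= e.
Proof.
move=> s0 e0 A0; have A1 : 0 < A + 1 by rewrite ltr_wpDl.
(* [A] may be zero, hence the denominator [A + 1]. *)
exists (Num.min s e / (A + 1)); first by rewrite divr_gt0// lt_min s0.
have m0 : 0 <= Num.min s e by rewrite le_min !ltW.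
have : Num.min s e / (A + 1) * A <= Num.min s e.
  by rewrite mulrAC ler_pdivrMr// ler_wpM2l// lerDl.
by rewrite le_min => /andP[].
Qed.

Section atomic_approximation.
Context {R : realType} {n : nat} {K : set 'rV[R]_n} {K0 : K !=set0}.

Local Notation KT := (pt_subspace K0).
Local Notation charges := (signed_measure K0).

Context {X : completeNormedModType R} {iota : charges -> X}.
Hypothesis iota_KR : is_KR_completion iota.
Hypothesis compactK : compact K.
Variables x y : nat -> KT.
(** The order [(y j, x j)] is that of plans, which carry mass from the first coordinate to the
    second: a piece near this pair contributes a multiple of [delta (x j) - delta (y j)]. *)
Hypothesis dense_yx : dense (range (fun j => (y j, x j))).

Local Notation w := (fun j => iota (atom_seq x y j)).

Lemma l1_rep_dipole (a : R) j : l1_rep w `|a| (a *: iota (dipole (x j) (y j))).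
Proof. by have := l1_repZ w a j.*2; rewrite /atom_seq odd_double doubleK. Qed.

Lemma l1_rep_delta (a : R) j : l1_rep w `|a| (a *: iota (delta (x j))).
Proof.
by have := l1_repZ w a j.*2.+1; rewrite /atom_seq /= odd_double uphalf_double.
Qed.

Lemma atomic_approximation_measure
    (m : {finite_measure set (borel KT) -> \bar R}) (mu : charges) (e : R) :
  0 < e -> (forall E, measurable E -> mu E = m E) ->
  exists2 v, l1_rep w (fine (m [set: borel KT])) v &
    `|iota mu - v| <= e * fine (m [set: borel KT]).
Proof.
move=> e0 muE; pose U j := [set b : KT | eucl_dist (x j) b < e].
have oU j : open (U j) by exact: open_eucl_ball.
have covU b : exists j, U j b.
  (* Leaving the first coordinate free, density of the pairs gives density of the [x j]. *)
  have [||t [bt [j _ jt]]] := @dense_yx [set z | eucl_dist b z.2 < e].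
  - by exists (b, b); rewrite /= eucl_distxx.
  - exact: (open_preimage_snd (open_eucl_ball b e)).
  by exists j; move: bt; rewrite /U -jt/= eucl_distC.
have [N [l [lN lU ml]]] :=
  borel_first_index (compact_pt_subspace compactK) oU covU.
exists (\sum_(j < N) fine (m (l @^-1` [set j : nat])) *: iota (delta (x j))).
  rewrite -(measure_index_total ml m lN); apply: l1_rep_sum => j.
  by rewrite -[X in l1_rep _ X _]ger0_norm ?fine_ge0//; exact: l1_rep_delta.
apply: (KR_completion_discretize iota_KR (f := id)) => //.
by move=> b; apply: ltW; exact: lU.
Qed.

Lemma atomic_approximation_plan
    (Psi : {finite_measure set (borel (KT * KT)%type) -> \bar R})
    (mu : charges) (e : R) : 0 < e -> transport_plans mu Psi ->
  (\int[Psi]_z (eucl_dist z.1 z.2)%:E < +oo)%E ->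
  exists2 v, l1_rep w (fine (\int[Psi]_z (eucl_dist z.1 z.2)%:E)
      + e * fine (Psi [set: borel (KT * KT)%type])) v &
    `|iota mu - v| <= 2 * e * fine (Psi [set: borel (KT * KT)%type]).
Proof.
(* The third condition bounds the coefficients of the dipoles without the
   triangle inequality for [eucl_dist]: continuity of the distance suffices. *)
move=> e0 muPsi Ifin; pose U j := [set z : KT * KT |
  [/\ eucl_dist (y j) z.1 < e, eucl_dist (x j) z.2 < e &
      eucl_dist (x j) (y j) < eucl_dist z.1 z.2 + e]].
have oU j : open (U j).
  rewrite (_ : U j = [set z | eucl_dist (y j) z.1 < e] `&`
    ([set z | eucl_dist (x j) z.2 < e] `&`
     [set z | eucl_dist (x j) (y j) - e < eucl_dist z.1 z.2])); last first.
    apply/seteqP; split=> z /=; first by case=> *; rewrite ltrBlDr.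
    by case=> ? []; rewrite ltrBlDr.
  apply: openI; first exact: (open_preimage_fst (open_eucl_ball (y j) e)).
  apply: openI; first exact: (open_preimage_snd (open_eucl_ball (x j) e)).
  exact/open_gt_continuous/eucl_dist_continuous.
have covU z : exists j, U j z.
  (* For fixed [z], [V] is the condition [U j z] read as a condition on [(y j, x j)]; it is open and
     contains [z]. *)
  pose V := [set t : KT * KT | eucl_dist z.1 t.1 < e] `&`
    ([set t | eucl_dist z.2 t.2 < e] `&`
     [set t | eucl_dist t.1 t.2 < eucl_dist z.1 z.2 + e]).
  have oV : open V.
    apply: openI; first exact: (open_preimage_fst (open_eucl_ball z.1 e)).
    apply: openI; first exact: (open_preimage_snd (open_eucl_ball z.2 e)).
    exact/open_lt_continuous/eucl_dist_continuous.
  have V0 : V !=set0 by exists z; rewrite /V/= !eucl_distxx ltrDl.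
  have [t [Vt [j _ jt]]] := dense_yx V0 oV.
  move: Vt; rewrite -jt => -[/= zy [zx zyx]]; exists j; split=> /=.
  - by rewrite eucl_distC.
  - by rewrite eucl_distC.
  - by rewrite eucl_distC.
have cKK : compact [set: (KT * KT)%type].
  by rewrite -setXTT; apply: compact_setX; exact: compact_pt_subspace.
have [N [l [lN lU ml]]] := borel_first_index cKK oU covU.
pose c j := fine (Psi (l @^-1` [set j : nat])).
have mfst := @measurable_fst_borel R n K K0.
have msnd := @measurable_snd_borel R n K K0.
pose mu2 : charges := charge_of_finite_measure (image_measure Psi msnd).
pose mu1 : charges := charge_of_finite_measure (image_measure Psi mfst).
pose d j := eucl_dist (x j) (y j).
exists (\sum_(j < N) (c j * d j) *: iota (dipole (x j) (y j))).
  apply: (@l1_repW _ _ _ (\sum_(j < N) `|c j * d j|)); last first.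
    by apply: l1_rep_sum => j; exact: l1_rep_dipole.
  (* On the piece of index [j] the function [h] dominates the constant [d j], so its integral bounds
     the sum of the [c j * d j]. *)
  pose h (z : borel (KT * KT)%type) : \bar R :=
    ((eucl_dist z.1 z.2)%:E + e%:E)%E.
  have mh : measurable_fun [set: borel (KT * KT)%type] h.
    by apply: emeasurable_funD => //; exact: measurable_eucl_dist.
  have h0 z : (0 <= h z)%E by rewrite adde_ge0// lee_fin ?eucl_dist_ge0// ltW.
  have Ih : (\int[Psi]_z h z = \int[Psi]_z (eucl_dist z.1 z.2)%:E +
      e%:E * Psi [set: borel (KT * KT)%type])%E.
    rewrite ge0_integralD//.
    - by rewrite integral_cst.
    - by move=> z _; rewrite lee_fin eucl_dist_ge0.
    - exact: measurable_eucl_dist.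
    - by move=> z _; rewrite lee_fin ltW.
  rewrite -lee_fin EFinD EFinM !fineK ?fin_num_measure//; last first.
    rewrite ge0_fin_numE//; apply: integral_ge0 => z _.
    by rewrite lee_fin eucl_dist_ge0.
  pose F j : set (borel (KT * KT)%type) := l @^-1` [set j].
  rewrite -Ih (_ : [set: borel (KT * KT)%type] =
    \big[setU/set0]_(0 <= j < N) F j); last first.
    rewrite big_mkord -bigcup_mkord; apply/seteqP; split=> // z _.
    by exists (l z) => //=.
  rewrite ge0_integral_bigsetU//=; last 3 first.
  - exact: iota_uniq.
  - by move=> i j _ _ [t [/= <- <-]].
  - exact: measurable_funTS.
  rewrite big_mkord -sumEFin; apply: lee_sum => j _.
  rewrite ger0_norm; last by rewrite mulr_ge0 ?fine_ge0 ?eucl_dist_ge0.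
  rewrite /c EFinM fineK ?fin_num_measure// muleC -integral_cst//.
  apply: ge0_le_integral => //.
  - by move=> z _; rewrite lee_fin eucl_dist_ge0.
  - exact: measurable_funTS.
  - by move=> z /= zj; have [_ _ /ltW] := lU z; rewrite zj.
(* [mu] is the second marginal of [Psi] minus the first. One partition of [K * K] serves both, so
   the two discretizations share the weights [c j] and pair up into dipoles. *)
have -> : iota mu = iota mu2 - iota mu1.
  rewrite -(KR_completionB iota_KR); apply: (KR_completion_eq iota_KR) => E mE.
  rewrite -muPsi//.
  congr (Psi _ - Psi _)%E; apply/seteqP; split => z /=; tauto.
have -> : \sum_(j < N) (c j * d j) *: iota (dipole (x j) (y j)) =
    \sum_(j < N) c j *: iota (delta (x j)) -
    \sum_(j < N) c j *: iota (delta (y j)).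
  rewrite -sumrB; apply: eq_bigr => j _.
  by rewrite -scalerA (KR_completion_dipole iota_KR) scalerBr.
(* Regrouping by marginal: each contributes an error [e] times the mass of [Psi], whence the factor
   2. *)
rewrite opprB addrACA [- _ - _]addrC -addrACA -(opprB (iota mu1)).
apply: le_trans (ler_normB _ _) _.
rewrite -mulrA mulr2n mulrDl mul1r lerD//.
  apply: (KR_completion_discretize iota_KR msnd) => //.
  by move=> z; have [_ /ltW] := lU z.
apply: (KR_completion_discretize iota_KR mfst) => //.
by move=> z; have [/ltW] := lU z.
Qed.

(** The strict inequality leaves a gap between [r] and the total cost of suitable [nu] and [Psi];
    this gap absorbs the excess coefficients due to discretization. *)
Lemma atomic_approximation (mu : charges) (r e : R) :
  0 < e -> (KR_norm mu < r%:E)%E ->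
  exists2 v, l1_rep w r v & `|iota mu - v| <= e.
Proof.
move=> e0 mur.
have [_ [nu _ <-] nur] := ereal_inf_lt mur.
have [m1 [m2 [sigmaE tvE]]] := total_variation_jordan (cadd mu (copp nu)).
rewrite tvE in nur.
have KR0r : (KR0_norm nu < r%:E - (m1 [set: borel KT] + m2 [set: borel KT]))%E.
  by rewrite lteBrDr ?fin_numD ?fin_num_measure.
have [_ [Psi nuPsi <-] Psir] := ereal_inf_lt KR0r.
set I := (\int[Psi]_z _)%E in Psir.
have I0 : (0 <= I)%E.
  by apply: integral_ge0 => z _; rewrite lee_fin eucl_dist_ge0.
pose M1 := fine (m1 [set: borel KT]).
pose M2 := fine (m2 [set: borel KT]).
pose MP := fine (Psi [set: borel (KT * KT)%type]).
have m1E : m1 [set: borel KT] = M1%:E by rewrite fineK// fin_num_measure.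
have m2E : m2 [set: borel KT] = M2%:E by rewrite fineK// fin_num_measure.
have M10 : 0 <= M1 by exact: fine_ge0.
have M20 : 0 <= M2 by exact: fine_ge0.
have MP0 : 0 <= MP by exact: fine_ge0.
rewrite m1E m2E -(EFinD M1 M2) -EFinB in Psir.
have Ifin : (I < +oo)%E by apply: lt_trans Psir _; exact: ltry.
have IE : I = (fine I)%:E by rewrite fineK// ge0_fin_numE.
rewrite IE lte_fin in Psir.
pose s := r - (M1 + M2) - fine I.
have s0 : 0 < s by rewrite subr_gt0.
(* [c] is the fineness of the partitions: [2 * MP] accounts for the two marginals of [Psi], [M1] and
   [M2] for the Jordan parts of [mu - nu]. *)
have [|||c c0 [cs ce]] := @small_factor R s e (2 * MP + M1 + M2) => //.
  by rewrite !addr_ge0// mulr_ge0.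
have [v vrep vnu] := atomic_approximation_plan c0 nuPsi Ifin.
pose mu1 : charges := charge_of_finite_measure m1.
pose mu2 : charges := charge_of_finite_measure m2.
have [v1 v1rep v1mu] :=
  @atomic_approximation_measure m1 mu1 c c0 (fun _ _ => erefl).
have [v2 v2rep v2mu] :=
  @atomic_approximation_measure m2 mu2 c c0 (fun _ _ => erefl).
exists (v + (v1 - v2)).
  apply: (@l1_repW _ _ _ (fine I + c * MP + (M1 + M2))).
    (* Only the plan has excess coefficients, at most [c * MP], which fits into the gap [s]. *)
    have /le_trans/(_ cs) : c * MP <= c * (2 * MP + M1 + M2).
      by rewrite ler_pM2l//; move: MP0 M10 M20; clear; lra.
    by rewrite /s; clear; lra.
  apply: l1_repD => //; apply: l1_repD => //; exact: l1_repN.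
have -> : iota mu = iota nu + (iota mu1 - iota mu2).
  rewrite -(KR_completionB iota_KR) -(KR_completionD iota_KR).
  apply: (KR_completion_eq iota_KR) => E mE.
  have munu : (mu E - nu E = m1 E - m2 E)%E := sigmaE E mE.
  rewrite -[RHS]/(nu E + (m1 E - m2 E))%E -munu addeC subeK//.
  exact: fin_num_measure.
rewrite opprD addrACA; apply: le_trans (ler_normD _ _) _.
rewrite opprB addrACA [- _ - _]addrC -addrACA -(opprB (iota mu2)).
apply: le_trans (lerD vnu (ler_normB _ _)) _.
apply: le_trans (lerD (lexx _) (lerD v1mu v2mu)) _.
apply: le_trans ce; rewrite -/MP -/M1 -/M2.
by rewrite [leRHS]mulrDr mulrDr -addrA mulrCA mulrA.
Qed.

End atomic_approximation.

(** * Paired sums, dense products and bounded closures *)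

Lemma sum_nat_double (V : nmodType) (F : nat -> V) (n : nat) :
  \sum_(0 <= i < n.*2) F i = \sum_(0 <= j < n) (F j.*2 + F j.*2.+1).
Proof.
elim: n => [|n IHn]; first by rewrite !big_geq.
by rewrite doubleS !big_nat_recr//= IHn addrA.
Qed.

Lemma cvg_double : (fun n => n.*2) @ \oo --> \oo.
Proof.
move=> A [N _ NA]; exists N => // n /= Nn; apply: NA => /=.
by apply: leq_trans Nn _; rewrite -addnn leq_addr.
Qed.

Lemma dense_setX (T U : topologicalType) (A : set T) (B : set U) :
  dense A -> dense B -> dense (A `*` B).
Proof.
move=> dA dB O [[t u] Otu] oO.
have [[P Q] /= [Pt Qu] PQO] : nbhs (t, u) O by exact: open_nbhs_nbhs.
have [|s [Ps As]] := dA P° _ (@open_interior _ P); first by exists t.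
have [|v [Qv Bv]] := dB Q° _ (@open_interior _ Q); first by exists u.
by exists (s, v); split=> //; apply: PQO; split; exact: interior_subset.
Qed.

Lemma bounded_closure (R : realFieldType) (V : normedModType R) (A : set V) :
  bounded_set A -> bounded_set (closure A).
Proof.
move=> [M [Mreal MA]]; exists M; split=> // N MN a clAa.
rewrite /=; apply/ler_addgt0Pr => e e0.
have [b [Ab /= ab]] := clAa _ (nbhsx_ballx a e e0).
rewrite -[a](subrK b) addrC; apply: le_trans (ler_normD _ _) _.
by rewrite lerD ?(MA _ MN)// ltW//; move: ab; rewrite -ball_normE.
Qed.

(** * Finite support of the atoms *)

Section delta_atom_theory.
Context {R : realType} {n : nat} {K : set 'rV[R]_n} {K0 : K !=set0}.

Local Notation KT := (pt_subspace K0).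
Local Notation charges := (signed_measure K0).

(** The complement of the two points is open, and its variation is computed from values of [mu] on
    sets avoiding both; so no other point is in the support. Dirac measures are the case [a = b]. *)
Lemma delta_atom_pair (mu : charges) (a b : KT) :
  (forall E, ~ E a -> ~ E b -> mu E = 0%E) -> delta_atom mu.
Proof.
move=> mu0; apply: (sub_finite_set _ (finite_set2 a b)) => z suppz.
apply: contrapT => zab; pose U := ~` [set a] `&` ~` [set b].
have oU : open U.
  by apply: openI; apply: closed_openC; exact: closed_pt_subspace1.
have Uz : U z by split=> zE; apply: zab; [left|right].
have := suppz U oU Uz.
have [P [N [mP mN ->]]] := total_variation_hahn mu; last first.
  exact: open_borel_measurable.
have mU0 Q : mu (U `&` Q) = 0%E.
  by apply: mu0 => -[[na nb] _]; [exact: na|exact: nb].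
by rewrite !mU0 subee// ltxx.
Qed.

Lemma delta_atom_atom_seq (x y : nat -> KT) (j : nat) :
  delta_atom (atom_seq x y j).
Proof.
have delta0 (a : KT) E : ~ E a -> delta a E = 0%E.
  by move=> nEa; rewrite /delta /= /charge_of_finite_measure diracE memNset.
rewrite /atom_seq; case: ifP => _.
  by apply: (@delta_atom_pair _ (x j./2) (x j./2)) => E + _; exact: delta0.
apply: (@delta_atom_pair _ (x j./2) (y j./2)) => E Ex Ey.
rewrite -[LHS]/(_ * (delta (x j./2) E - delta (y j./2) E))%E.
by rewrite !delta0// subee// mule0.
Qed.

End delta_atom_theory.

(** * The expansion with constant [1 / 4], and the span of the atoms *)

Theorem theorem4p2 (R : realType) (n : nat) (Omega K : set 'rV[R]_n)
    (Omega_neq0 : Omega !=set0) (Omega_bounded : bounded_set Omega)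
    (Omega_open : open Omega) (K_closure : K = closure Omega)
    (K0 : K !=set0) (D1 D2 : set (pt_subspace K0))
    (D1_countable : countable D1) (D1_dense : dense D1)
    (D2_countable : countable D2) (D2_dense : dense D2)
    (D2_disjoint : D2 `<=` ~` D1)
    (x y : nat -> pt_subspace K0)
    (xy_enum : range (fun j => (x j, y j)) = D1 `*` D2)
    (X : completeNormedModType R) (iota : signed_measure K0 -> X)
    (X_completion : is_KR_completion iota) :
  (exists C : R, 0 < C < 1 /\
     forall mu : X, exists a1 a2 : nat -> R,
       [/\ cvgn (series (fun j => `|a1 j| + `|a2 j|)),
           series (fun j => a1 j *: iota (dipole (x j) (y j))
                            + a2 j *: iota (delta (x j))) @ \oo --> mu,
           C * limn (series (fun j => `|a1 j| + `|a2 j|)) <= `|mu|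
         & `|mu| <= limn (series (fun j => `|a1 j| + `|a2 j|))]) /\
  [/\ forall j : nat, delta_atom (atom_seq x y j),
      closure (linear_span (fun j => iota (atom_seq x y j))) = [set: X]
    & forall j : nat, (KR_norm (atom_seq x y j) <= 1)%E].
Proof.
pose w j := iota (atom_seq x y j).
have w1 j : `|w j| <= 1.
  rewrite /w /atom_seq; case: ifP => _.
    exact: KR_completion_delta_le.
  exact: KR_completion_dipole_le.
have compactK : compact K.
  rewrite K_closure; apply: bounded_closed_compact; last exact: closed_closure.
  exact: bounded_closure.
have dense_yx : dense (range (fun j => (y j, x j))).
  move=> O O0 oO; have [z [Oz [D2z D1z]]] := dense_setX D2_dense D1_dense O0 oO.
  have : (D1 `*` D2) (z.2, z.1) by split.
  rewrite -xy_enum => -[j _ [xj yj]]; exists z; split=> //; exists j => //.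
  by rewrite xj yj -surjective_pairing.
have approx v : exists2 v', l1_rep w (2 * `|v|) v' & `|v - v'| <= `|v| / 2.
  (* Zero is treated apart, since the strict bound [KR_norm mu < 2 |v|] below needs [v] nonzero. *)
  have [->|v0] := eqVneq v 0.
    by exists 0; rewrite ?normr0 ?mulr0 ?mul0r ?subrr ?normr0//; exact: l1_rep0.
  (* Half of the allowed error [|v| / 2] goes to density, half to the atomic approximation. *)
  have v40 : 0 < `|v| / 4 by rewrite divr_gt0// normr_gt0.
  have [||t [vmu [mu _ mut]]] :=
    KR_completion_dense X_completion (O := ball v (`|v| / 4)).
  - by exists v; exact: ballxx.
  - exact: ball_open.
  rewrite -mut -ball_normE /= in vmu.
  have [|v' v'rep muv'] := atomic_approximation X_completion compactK dense_yx
      (mu := mu) (r := 2 * `|v|) v40.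
    rewrite -(KR_completion_norm X_completion) lte_fin.
    have : `|iota mu| <= `|v| + `|v - iota mu|.
      by rewrite -{1}[iota mu](subKr v); exact: ler_normB.
    by lra.
  exists v' => //; have := ler_distD (iota mu) v v'; lra.
(* One factor 2 comes from [approx], the other from summing the stages; [C] is the inverse of their
   product. *)
have rep v : l1_rep w (4 * `|v|) v.
  by have := l1_rep_expansion _ w1 approx v; rewrite -natrM; apply.
split; last split.
- exists 4^-1; split; first by rewrite invr_gt0 ltr0n invf_lt1 ?ltr1n.
  move=> mu; have [a [aM amu]] := rep mu.
  pose a1 j := a j.*2; pose a2 j := a j.*2.+1.
  have normE m : series (fun j => `|a1 j| + `|a2 j|) m =
      \sum_(0 <= j < m.*2) `|a j| by rewrite sum_nat_double.
  have cvg12 : cvgn (series (fun j => `|a1 j| + `|a2 j|)).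
    apply: nondecreasing_is_cvgn; first exact: nondecreasing_series.
    by exists (4 * `|mu|) => _ [m _ <-]; rewrite normE.
  have cvgmu : series (fun j => a1 j *: iota (dipole (x j) (y j))
      + a2 j *: iota (delta (x j))) @ \oo --> mu.
    (* The paired series runs through the partial sums of even length of the expansion in [w]. *)
    rewrite (_ : series _ = series (fun j => a j *: w j) \o (fun m => m.*2)).
      exact: cvg_comp cvg_double amu.
    apply/funext => m; rewrite /series/= sum_nat_double.
    apply: eq_bigr => j _; rewrite /w /atom_seq /= odd_double doubleK.
    by rewrite uphalf_double.
  exists a1, a2; split=> //.
    rewrite ler_pdivrMl//; apply: limr_le => //.
    by apply: nearW => m; rewrite normE.
  (* The upper bound is the triangle inequality, all atoms having norm at most 1. *)
  apply: (cvgr_to_le (cvg_norm cvgmu)).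
  apply: nearW => m; apply: le_trans (ler_norm_sum _ _ _) _.
  apply: (@le_trans _ _ (series (fun j => `|a1 j| + `|a2 j|) m)).
    apply: ler_sum => j _; apply: le_trans (ler_normD _ _) _.
    rewrite !normrZ lerD// ler_piMr//.
      exact: (KR_completion_dipole_le X_completion).
    exact: (KR_completion_delta_le X_completion).
  apply: nondecreasing_cvgn_le => //; exact: nondecreasing_series.
- exact: delta_atom_atom_seq.
- apply/seteqP; split=> // v _ B vB.
  (* The partial sums of the expansion lie in the span and converge to [v]. *)
  have [a [_ av]] := rep v.
  have [N _ /(_ N (leqnn N))/= NB] := av _ vB.
  exists (series (fun j => a j *: w j) N); split=> //.
  by exists N, a; rewrite /series/= big_mkord.
- by move=> j; rewrite -(KR_completion_norm X_completion) lee_fin w1.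
Qed.
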